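(* Let $G:=N\rtimes_{\eta}K$ be a semidirect product of two finite groups $N$ and $K$ of coprime orders via the action $\eta:K\to\mathrm{Aut}(N)$. Then $G$ is of central type if and only if so are both $N$ and $K$ and, additionally, the action $\eta$ is symplectic. In particular, if $N=C_m\times C_m$, then $N\rtimes_\eta K$ is of central type if and only if $K$ is of central type and $\eta(K)\le \mathrm{SL}_2(m)$.
   Context: $C_m$ denotes the cyclic group of order $m$. For a finite group $G$ and a 2-cocycle $f\in Z^2(G,\mathbb{C}^* )$ (trivial action of $G$ on $\mathbb{C}^*$), the twisted group algebra $\mathbb{C}^fG$ is the $\mathbb{C}$-algebra with basis $\{u_g\}_{g\in G}$ and multiplication $u_{g}u_{h}=f(g,h)u_{gh}$. The class $[f]\in H^2(G,\mathbb{C}^* )$ is non-degenerate if $\mathbb{C}^fG$ is isomorphic to a matrix algebra over $\mathbb{C}$ (i.e. is simple). A finite group $G$ is of central type if it admits a non-degenerate class. $\mathrm{Aut}(G)$ acts on $H^2(G,\mathbb{C}^* )$ by $\phi([f])=[\phi(f)]$, $\phi(f)(g_1,g_2)=f(\phi^{-1}(g_1),\phi^{-1}(g_2))$. The symplectic group of a non-degenerate class $[f]$ is $\mathrm{Sp}([f])=\{\phi\in\mathrm{Aut}(G): \phi([f])=[f]\}$. An action $\eta:K\to\mathrm{Aut}(N)$ of a group $K$ on $N$ is symplectic if there exists a non-degenerate class $[f]\in H^2(N,\mathbb{C}^* )$ such that $\eta(K)\le\mathrm{Sp}([f])$. Choosing two generators of $C_m\times C_m$ identifies $\mathrm{Aut}(C_m\times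 C_m)$ with $\mathrm{GL}_2(m)=\mathrm{GL}_2(\mathbb{Z}/m\mathbb{Z})$, and $\mathrm{SL}_2(m)$ is the subgroup of automorphisms of determinant $1\pmod m$. *)

(* Defs.v *)
From HB Require Import structures.
From mathcomp Require Import all_boot all_order all_algebra all_fingroup.
From mathcomp Require Import generic_quotient.
From mathcomp Require Import ring boolp.

Set Implicit Arguments.
Unset Strict Implicit.
Unset Printing Implicit Defensive.

Import GRing.Theory.
Local Open Scope ring_scope.

Section Cocycles.
Variables (F : fieldType) (gT : finGroupType).

(* Z^2(gT, F^x) for the trivial action; values in F^x are encoded as nonzero
   elements of F. No normalization f(1, 1) = 1 is imposed. *)
Definition is_cocycle (f : {ffun gT * gT -> F}) : bool :=
  [forall g, forall h, f (g, h) != 0] &&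
  [forall g, forall h, forall k,
     f (g, h) * f ((g * h)%g, k) == f (h, k) * f (g, (h * k)%g)].

Record cocycle := Cocycle {
  cocycle_ffun :> {ffun gT * gT -> F};
  cocycle_ffunP : is_cocycle cocycle_ffun }.

HB.instance Definition _ := [isSub for cocycle_ffun].
HB.instance Definition _ := [Choice of cocycle by <:].

Lemma cocycle_neq0 (f : cocycle) g h : f (g, h) != 0.
Proof.
by case: f => f /= /andP[/forallP/(_ g)/forallP/(_ h)].
Qed.

Lemma cocycleE (f : cocycle) g h k :
  f (g, h) * f ((g * h)%g, k) = f (h, k) * f (g, (h * k)%g).
Proof.
by case: f => f /= /andP[_ /forallP/(_ g)/forallP/(_ h)/forallP/(_ k)/eqP].
Qed.

Definition cohomologous (f f' : cocycle) : Prop :=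
  exists2 b : {ffun gT -> F}, (forall g, b g != 0) &
    forall g h, f' (g, h) = f (g, h) * (b g * b h / b (g * h)%g).

Lemma cohomologous_refl f : cohomologous f f.
Proof.
exists [ffun=> 1] => [g|g h]; first by rewrite ffunE oner_eq0.
by rewrite !ffunE mul1r divr1 mulr1.
Qed.

Lemma cohomologous_sym f f' : cohomologous f f' -> cohomologous f' f.
Proof.
case=> b b0 fE; exists [ffun g => (b g)^-1] => [g|g h].
  by rewrite ffunE invr_eq0.
by rewrite !ffunE fE; field; rewrite !b0 oner_eq0.
Qed.

Lemma cohomologous_trans f1 f2 f3 :
  cohomologous f1 f2 -> cohomologous f2 f3 -> cohomologous f1 f3.
Proof.
move=> [b b0 bE] [c c0 cE]; exists [ffun g => b g * c g] => [g|g h].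
  by rewrite ffunE mulf_neq0.
by rewrite cE bE !ffunE; field; rewrite b0 c0.
Qed.

Definition cohomologousb : rel cocycle := fun f f' => `[< cohomologous f f' >].

Lemma cohomologousb_refl : reflexive cohomologousb.
Proof. by move=> f; apply/asboolP/cohomologous_refl. Qed.

Lemma cohomologousb_sym : symmetric cohomologousb.
Proof.
by move=> f f'; apply/asboolP/asboolP; apply: cohomologous_sym.
Qed.

Lemma cohomologousb_trans : transitive cohomologousb.
Proof.
move=> f f1 f2 /asboolP h1 /asboolP h2.
by apply/asboolP; apply: cohomologous_trans h1 h2.
Qed.

Canonical cohomologous_equiv :=
  EquivRel cohomologousb cohomologousb_refl cohomologousb_sym
           cohomologousb_trans.

Definition H2 : choiceType := {eq_quot cohomologousb}%qT.

Definition coh_class (f : cocycle) : H2 := \pi_({eq_quot cohomologousb})%qT f.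

Lemma coh_classP f f' : coh_class f = coh_class f' <-> cohomologous f f'.
Proof.
by split=> [/eqmodP/asboolP // | h]; apply/eqmodP/asboolP.
Qed.

(* The fallback value of insubd is only used when phi is not an automorphism,
   see aut_cocycleE. *)
Definition aut_cocycle (phi : {perm gT}) (f : cocycle) : cocycle :=
  insubd f [ffun p : gT * gT => f ((phi^-1)%g p.1, (phi^-1)%g p.2)].

Lemma aut_cocycleE phi f g h : phi \in Aut [set: gT] ->
  aut_cocycle phi f (g, h) = f ((phi^-1)%g g, (phi^-1)%g h).
Proof.
move=> /groupVr; rewrite inE => /andP[_ /morphicP phiM].
rewrite /aut_cocycle /insubd insubT /=; last by rewrite ffunE.
apply/andP; split.
  by apply/forallP=> x; apply/forallP=> y; rewrite ffunE cocycle_neq0.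
apply/forallP=> x; apply/forallP=> y; apply/forallP=> z.
by rewrite !ffunE /= !phiM ?inE // cocycleE.
Qed.

Definition aut_H2 (phi : {perm gT}) (c : H2) : H2 :=
  coh_class (aut_cocycle phi (repr (c : {eq_quot cohomologousb}%qT))).

Lemma aut_H2E phi f : phi \in Aut [set: gT] ->
  aut_H2 phi (coh_class f) = coh_class (aut_cocycle phi f).
Proof.
move=> phiA; apply/coh_classP.
have /coh_classP[b b0 bE] :
    coh_class (repr (coh_class f : {eq_quot cohomologousb}%qT)) = coh_class f.
  by rewrite /coh_class reprK.
exists [ffun g => b ((phi^-1)%g g)] => [g|g h]; first by rewrite ffunE.
rewrite !aut_cocycleE // bE !ffunE.
move: phiA => /groupVr; rewrite inE => /andP[_ /morphicP phiM].
by rewrite phiM ?inE.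
Qed.

End Cocycles.

Section TwistedGroupAlgebra.
Variables (F : fieldType) (gT : finGroupType).

(* The vector space underlying F^f gT, as coordinates in the basis (u_g).
   The alias hides the pointwise product of {ffun _ -> _}. *)
Definition twisted_alg (f : cocycle F gT) : Type := {ffun gT -> F^o}.

Variable f : cocycle F gT.
Local Notation A := (twisted_alg f).

HB.instance Definition _ := GRing.Lmodule.copy A {ffun gT -> F^o}.

Definition twisted_basis (g : gT) : A := [ffun h => (h == g)%:R].
Local Notation u := twisted_basis.

(* Bilinear extension of u_g u_h = f(g, h) u_(gh), see twisted_basisM. *)
Definition twisted_mul (a b : A) : A :=
  [ffun k => \sum_g a g * b (g^-1 * k)%g * f (g, (g^-1 * k)%g)].

(* f is not assumed to be normalized. *)
Definition twisted_one : A := (f (1%g, 1%g))^-1 *: u 1%g.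

Let f1r g : f (g, 1%g) = f (1%g, 1%g).
Proof.
have := cocycleE f g 1%g 1%g; rewrite !mulg1.
by move/(mulIf (cocycle_neq0 f g 1%g)).
Qed.

Let f1l g : f (1%g, g) = f (1%g, 1%g).
Proof.
have := cocycleE f 1%g 1%g g; rewrite !mul1g.
by move/(mulIf (cocycle_neq0 f 1%g g)) => ->.
Qed.

Lemma twisted_mulA : associative twisted_mul.
Proof.
move=> a b c; apply/ffunP=> k; rewrite !ffunE.
under eq_bigr => g _ do rewrite ffunE mulr_sumr mulr_suml.
under [RHS]eq_bigr => h _ do rewrite ffunE mulr_suml mulr_suml.
rewrite [RHS]exchange_big; apply: eq_bigr => g _ /=.
rewrite (reindex_inj (mulgI g^-1)%g) /=; apply: eq_bigr => h _.
rewrite invMg invgK -!mulgA mulKVg.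
have := cocycleE f g (g^-1 * h)%g (h^-1 * k)%g.
rewrite mulKVg -!mulgA mulKVg => e.
by rewrite -!mulrA; do 2!congr (_ * _); rewrite [RHS]mulrCA -e; congr (_ * _).
Qed.

Lemma twisted_mul1r : left_id twisted_one twisted_mul.
Proof.
move=> a; apply/ffunP=> k; rewrite !ffunE (bigD1 1%g) //= big1 ?addr0.
  rewrite !ffunE eqxx invg1 mul1g f1l [_ *: _]mulr1 mulrAC mulVf ?mul1r //.
  exact: cocycle_neq0.
by move=> g /negPf g1; rewrite !ffunE g1 scaler0 !mul0r.
Qed.

Lemma twisted_mulr1 : right_id twisted_one twisted_mul.
Proof.
move=> a; apply/ffunP=> k; rewrite !ffunE (bigD1 k) //= big1 ?addr0.
  rewrite !ffunE mulVg eqxx f1r [_ *: _]mulr1 -mulrA mulVf ?mulr1 //.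
  exact: cocycle_neq0.
move=> g gk; rewrite !ffunE -eq_mulVg1 (negPf gk) scaler0.
by rewrite mulr0 mul0r.
Qed.

Lemma twisted_mulDl : left_distributive twisted_mul +%R.
Proof.
move=> a b c; apply/ffunP=> k; rewrite !ffunE -big_split /=.
by apply: eq_bigr => g _; rewrite !ffunE !mulrDl.
Qed.

Lemma twisted_mulDr : right_distributive twisted_mul +%R.
Proof.
move=> a b c; apply/ffunP=> k; rewrite !ffunE -big_split /=.
by apply: eq_bigr => g _; rewrite !ffunE mulrDr mulrDl.
Qed.

Lemma twisted_one_neq0 : twisted_one != 0.
Proof.
apply/eqP=> /ffunP/(_ 1%g)/eqP; rewrite !ffunE eqxx [_ *: _]mulr1.
by rewrite invr_eq0; apply/negP; apply: cocycle_neq0.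
Qed.

HB.instance Definition _ := GRing.Zmodule_isNzRing.Build A
  twisted_mulA twisted_mul1r twisted_mulr1 twisted_mulDl twisted_mulDr
  twisted_one_neq0.

Lemma twisted_scalerAl (x : F) (a b : A) : x *: (a * b) = (x *: a) * b.
Proof.
apply/ffunP=> k; rewrite !ffunE [LHS]mulr_sumr.
by apply: eq_bigr => g _; rewrite !ffunE -!mulrA.
Qed.

Lemma twisted_scalerAr (x : F) (a b : A) : x *: (a * b) = a * (x *: b).
Proof.
apply/ffunP=> k; rewrite !ffunE [LHS]mulr_sumr.
apply: eq_bigr => g _; rewrite !ffunE !mulrA; congr (_ * _ * _).
exact: mulrC.
Qed.

HB.instance Definition _ := GRing.Lmodule_isLalgebra.Build F A twisted_scalerAl.
HB.instance Definition _ := GRing.Lalgebra_isAlgebra.Build F A twisted_scalerAr.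

Lemma twisted_basisM g h : u g * u h = f (g, h) *: u (g * h)%g.
Proof.
apply/ffunP=> k; rewrite !ffunE (bigD1 g) //= big1 ?addr0.
  rewrite !ffunE eqxx mul1r -(inj_eq (mulgI g)) mulKVg [RHS]mulrC.
  by case: eqP => [->|_]; rewrite ?mul0r // mulKg.
by move=> i /negPf ig; rewrite !ffunE ig !mul0r.
Qed.

End TwistedGroupAlgebra.

Section CentralType.
Variables (F : fieldType) (gT : finGroupType).

Definition is_matrix_alg (A : algType F) : Prop :=
  exists (n : nat) (phi : {lrmorphism A -> 'M[F]_n.+1}), bijective phi.

Definition nondegenerate (c : H2 F gT) : Prop :=
  exists2 f : cocycle F gT, coh_class f = c & is_matrix_alg (twisted_alg f).

Lemma twisted_alg_cohomologous (f f' : cocycle F gT) :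
  cohomologous f f' ->
  is_matrix_alg (twisted_alg f) -> is_matrix_alg (twisted_alg f').
Proof.
case=> b b0 fE [n [phi [psi phiK psiK]]].
pose r (a : twisted_alg f') : twisted_alg f := [ffun g => a g * b g].
pose r' (a : twisted_alg f) : twisted_alg f' := [ffun g => a g / b g].
have rK : cancel r r' by move=> a; apply/ffunP=> g; rewrite !ffunE mulfK.
have r'K : cancel r' r by move=> a; apply/ffunP=> g; rewrite !ffunE mulfVK.
have rlin : linear r.
  move=> x a c; apply/ffunP=> g; rewrite !ffunE mulrDl.
  by congr (_ + _); apply/esym/mulrA.
have rmul : monoid_morphism r.
  split.
    apply/ffunP=> g; rewrite !ffunE; case: eqP => [->|_]; last first.
      by rewrite !scaler0 mul0r.
    rewrite fE mulg1 mulfK // invfM.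
    have s1 (x : F^o) : x *: (1 : F^o) = x by apply: mulr1.
    by rewrite !s1 mulfVK.
  move=> a c; apply/ffunP=> k; rewrite !ffunE mulr_suml.
  apply: eq_bigr => g _; rewrite !ffunE fE mulKVg.
  by field; rewrite b0.
pose rL : {linear twisted_alg f' -> twisted_alg f} :=
  HB.pack r (GRing.isLinear.Build F _ _ _ r rlin).
pose rM : {lrmorphism twisted_alg f' -> twisted_alg f} :=
  HB.pack r rL (GRing.isMonoidMorphism.Build _ _ r rmul).
exists n, (phi \o rM : {lrmorphism _ -> _}).
by exists (r' \o psi); [apply: can_comp phiK rK | apply: can_comp r'K psiK].
Qed.

Lemma nondegenerateE (f : cocycle F gT) :
  nondegenerate (coh_class f) <-> is_matrix_alg (twisted_alg f).
Proof.
split=> [[f' /coh_classP h]|]; first exact: twisted_alg_cohomologous h.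
by exists f.
Qed.

Definition central_type : Prop := exists c : H2 F gT, nondegenerate c.

Definition Sp (c : H2 F gT) : {set {perm gT}} :=
  [set phi in Aut [set: gT] | aut_H2 phi c == c].

End CentralType.

(* MathComp group actions are right actions and permutations compose from left
   to right, so that actperm eta is the homomorphism K -> Aut(N). *)
Definition symplectic (F : fieldType) (K N : finGroupType)
    (eta : groupAction [set: K] [set: N]) : Prop :=
  exists2 c : H2 F N, nondegenerate c & (actperm eta @* [set: K] \subset Sp c)%g.

(* Automorphisms of C_m x C_m = <[x]> \x <[y]> whose matrix in the generators
   (x, y) has determinant 1 modulo m. Residues modulo m are represented by
   'I_m, lifted to int to compute the determinant, since 'Z_1 is not Z/1Z. *)
Definition SL2 (gT : finGroupType) (m : nat) (x y : gT) : {set {perm gT}} :=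
  [set phi in Aut [set: gT] |
    [exists A : 'M['I_m]_2,
      [&& phi x == (x ^+ A ord0 ord0 * y ^+ A ord0 ord_max)%g,
          phi y == (x ^+ A ord_max ord0 * y ^+ A ord_max ord_max)%g
        & (\det (map_mx (fun i : 'I_m => (i : nat)%:Z) A) == 1 %[mod m])%Z]]].

(* Main.v *)
From HB Require Import structures.
Require Import Defs.
From mathcomp Require Import all_boot all_order all_algebra all_fingroup.
From mathcomp Require Import cyclic separable cyclotomic.
From mathcomp Require Import boolp ring reals complex.

Set Implicit Arguments.
Unset Strict Implicit.
Unset Printing Implicit Defensive.

Import GRing.Theory Num.Theory.
Local Open Scope ring_scope.

(** Everything is done with projective representations: families p of n x n
matrices indexed by the group, with p g p h = f(g, h) p (g h). Non-degeneracy
of f is a statement about traces and degrees ([is_matrix_algP]): the twisted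
group algebra of f is a matrix algebra if and only if f has a projective
representation of degree n with n^2 = |G| whose trace vanishes off 1. Indeed
an isomorphism with M_n sends the u_g to such a family, because the sum of the
conjugates of u_g is then a scalar; conversely, vanishing traces make the
family linearly independent, hence a basis of M_n. Moreover, every cocycle has
a projective representation that spans the matrices of its degree
([exists_spanning]), found by minimizing the degree, and f is non-degenerate
as soon as n^2 = |G| for such a representation.

Restriction to a Hall subgroup. Let p be a representation of degree d of a
non-degenerate f on G, and let s be any representation of degree w of the
restriction of f to H. Averaging T |-> p(h) T s(h)^-1 over H is a projector on
the d x w matrices, of trace d w / |H| because the traces of p vanish off 1.
So |H| divides d w ([dvdn_card_degree]). As d^2 = |G| and |H| is prime to its
index, |H| divides w^2; for a spanning s, w^2 <= |H|, so w^2 = |H| and the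
restriction is non-degenerate ([hall_nondegenerate]). This handles both factors
of the semidirect product G of N by K, and the restriction to N of a class of
G is fixed by conjugation by K, so that the action is symplectic.

Construction on the semidirect product. Let the class of f on N be
non-degenerate and K-invariant. Since the class is killed by |N| and |K| is
prime to |N|, a suitable power of the product of the K-translates of f is a
cocycle in the same class which is invariant on the nose
([invariant_cocycle]). For a representation p of it as above, the same trace
computation yields an invertible T_k with p(x) T_k = T_k p(x^k), unique up to
a scalar, so that T is a projective representation of K. If s is such a
representation of a non-degenerate cocycle of K, then the tensor products of
T_k p(x) with s(k) form a projective representation of G of degree sqrt |G|
with traces vanishing off 1, whence G is of central type
([sdprod_central_type]).

For abelian N the class of f is determined by the pairing f(x, y) / f(y, x),
because a symmetric cocycle has a representation of degree 1. If N is the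
product of two cyclic groups <x> and <y> of order m, the class is
non-degenerate if and only if the value w of the pairing at (x, y) has order
m, and an automorphism of determinant D replaces w by w^D. So, whatever the
non-degenerate class, its stabilizer is SL_2(m) ([rank2_symplectic]). *)

(** * Families of matrices *)
Section MatrixFamilies.
Variables (F : fieldType) (I : finType) (n : nat).
Implicit Type p : I -> 'M[F]_n.

Definition spanning p := forall M, exists a : I -> F, M = \sum_i a i *: p i.

Definition lin_indep p :=
  forall a : I -> F, \sum_i a i *: p i = 0 -> forall i, a i = 0.

(* The family as a single matrix, one vectorized member per row. *)
Let fam_mx p : 'M[F]_(#|I|, n * n) := \matrix_i mxvec (p (enum_val i)).

Let mul_fam_mx p (v : 'rV_#|I|) :
  v *m fam_mx p = mxvec (\sum_i v 0 (enum_rank i) *: p i).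
Proof.
rewrite mulmx_sum_row linear_sum /= (reindex enum_rank) /=.
  by apply: eq_bigr => i _; rewrite linearZ rowK enum_rankK.
by apply: onW_bij; apply: enum_rank_bij.
Qed.

Lemma spanning_row_full p : spanning p <-> row_full (fam_mx p).
Proof.
split=> [sp|/row_fullP[B BQ] M].
  rewrite -sub1mx; apply/row_subP=> i.
  have [a aE] := sp (vec_mx (row i 1%:M)).
  apply/submxP; exists (\row_j a (enum_val j)).
  rewrite mul_fam_mx -[LHS]vec_mxK aE; congr mxvec.
  by apply: eq_bigr => j _; rewrite mxE enum_rankK.
exists (fun i => (mxvec M *m B) 0 (enum_rank i)).
by apply: (can_inj mxvecK); rewrite -mul_fam_mx -mulmxA BQ mulmx1.
Qed.

Lemma lin_indep_row_free p : lin_indep p <-> row_free (fam_mx p).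
Proof.
split=> [li|fQ a a0 i].
  rewrite -kermx_eq0; apply/rowV0P=> v /sub_kermxP.
  rewrite mul_fam_mx => /(canRL mxvecK); rewrite linear0 => /li v0.
  by apply/rowP=> j; have := v0 (enum_val j); rewrite enum_valK mxE.
have : (\row_j a (enum_val j)) *m fam_mx p = 0.
  rewrite mul_fam_mx -[RHS](linear0 mxvec) -[in RHS]a0; congr mxvec.
  by apply: eq_bigr => j _; rewrite mxE enum_rankK.
rewrite -[X in _ = X](mul0mx _ (fam_mx p)) => /(row_free_inj fQ).
by move/rowP/(_ (enum_rank i)); rewrite !mxE enum_rankK.
Qed.

Lemma spanning_le p : spanning p -> (n * n <= #|I|)%N.
Proof. by move/spanning_row_full/eqP<-; apply: rank_leq_row. Qed.

Lemma spanning_indep p : (n * n)%N = #|I| -> spanning p <-> lin_indep p.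
Proof.
move=> nn; rewrite spanning_row_full lin_indep_row_free.
by rewrite /row_full /row_free; move: (\rank _) => r; rewrite nn.
Qed.

Lemma spanning_indep_card p : spanning p -> lin_indep p -> (n * n)%N = #|I|.
Proof.
by move=> /spanning_row_full/eqP<- /lin_indep_row_free/eqP->.
Qed.

End MatrixFamilies.

Lemma mulmx_delta_entry (F : fieldType) n m (A : 'M[F]_n) (B : 'M[F]_m)
    i j k l :
  (A *m delta_mx j k *m B) i l = A i j * B k l.
Proof.
rewrite !mxE (bigD1 k) //= big1 ?addr0 => [|k' /negPf k'k].
  rewrite !mxE (bigD1 j) //= big1 ?addr0 => [|j' /negPf j'j].
    by rewrite !mxE !eqxx mulr1.
  by rewrite !mxE j'j mulr0.
rewrite !mxE big1 ?mul0r // => j' _.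
by rewrite !mxE k'k andbF mulr0.
Qed.

Lemma scale_unitmx_inj (F : fieldType) n (A : 'M[F]_n) :
  (0 < n)%N -> A \in unitmx -> injective (fun c => c *: A).
Proof.
move=> n0 uA a b /= /(congr1 (mulmx^~ (invmx A))); rewrite -!scalemxAl.
rewrite mulmxV // !scalemx1; case: n n0 A uA => // n _ A _ /matrixP/(_ 0 0).
by rewrite !mxE eqxx !mulr1n.
Qed.

Lemma unitmx_neq0 (F : fieldType) n (A : 'M[F]_n) :
  (0 < n)%N -> A \in unitmx -> A != 0.
Proof.
move=> n0 uA; apply/eqP=> A0; have := scale_unitmx_inj n0 uA.
move=> /(_ 0 1); rewrite A0 !scaler0 => /(_ erefl)/esym/eqP.
by rewrite oner_eq0.
Qed.

(** * Projective representations *)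
Lemma cocycle1r (F : fieldType) (gT : finGroupType) (f : cocycle F gT) g :
  f (g, 1%g) = f (1%g, 1%g).
Proof.
have := cocycleE f g 1%g 1%g; rewrite !mulg1.
by move/(mulIf (cocycle_neq0 f g 1%g)).
Qed.

Lemma cocycle1l (F : fieldType) (gT : finGroupType) (f : cocycle F gT) g :
  f (1%g, g) = f (1%g, 1%g).
Proof.
have := cocycleE f 1%g 1%g g; rewrite !mul1g.
by move/(mulIf (cocycle_neq0 f 1%g g)) => ->.
Qed.

Lemma group_card_neq0 (F : numClosedFieldType) (gT : finGroupType) :
  #|gT|%:R != 0 :> F.
Proof. by rewrite pnatr_eq0 -lt0n; apply/card_gt0P; exists 1%g. Qed.

Section ProjRep.
Variables (F : numClosedFieldType) (gT : finGroupType).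

Definition proj_rep (f : gT * gT -> F) n (p : gT -> 'M[F]_n) : Prop :=
  p 1%g = (f (1%g, 1%g))%:M /\
  forall g h, p g *m p h = f (g, h) *: p (g * h)%g.

Section Basics.
Variables (f : cocycle F gT) (n : nat) (p : gT -> 'M[F]_n).
Hypothesis fp : proj_rep f p.

Lemma proj_repM g h : p g *m p h = f (g, h) *: p (g * h)%g.
Proof. by case: fp. Qed.

Lemma proj_rep1 : p 1%g = (f (1%g, 1%g))%:M.
Proof. by case: fp. Qed.

Lemma proj_rep_unit g : p g \in unitmx.
Proof.
have /mulmx1_unit[] // : p g *m
   ((f (g, g^-1%g) * f (1%g, 1%g))^-1 *: p g^-1%g) = 1%:M.
rewrite -scalemxAr proj_repM scalerA mulgV proj_rep1 scale_scalar_mx.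
by congr (_ %:M); field; rewrite !cocycle_neq0.
Qed.

(** The trace form detects coefficients: the trace of p(g^-1) times a
combination of the p(h) only sees the coefficient of p(g). *)
Lemma proj_rep_trace_indep :
  (0 < n)%N -> (forall g, g != 1%g -> \tr (p g) = 0) -> lin_indep p.
Proof.
move=> n0 tr0 a a0 g.
have /(congr1 mxtrace) : p g^-1%g *m (\sum_i a i *: p i) = 0.
  by rewrite a0 mulmx0.
rewrite mulmx_sumr linear_sum linear0 /= (bigD1 g) //= big1 => [|h hg].
  rewrite -scalemxAr proj_repM mulVg proj_rep1 addr0 !linearZ /= mxtrace_scalar.
  move/eqP; rewrite !mulf_eq0 mulrn_eq0 !(negPf (cocycle_neq0 _ _ _)) !orbF.
  by rewrite -[n == 0%N]negbK -lt0n n0 orbF => /eqP.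
rewrite -scalemxAr proj_repM !linearZ /= tr0 ?mulr0 //.
by rewrite -eq_mulVg1 eq_sym.
Qed.

End Basics.

(** Up to the factor |G|, this is the projection of a matrix T onto the
intertwiners from s to p. *)
Definition conj_sum_mx n m (p : gT -> 'M[F]_n) (s : gT -> 'M[F]_m)
    (T : 'M_(n, m)) :=
  \sum_g p g *m T *m invmx (s g).

Lemma conj_sum_mxP (f : cocycle F gT) n m (p : gT -> 'M[F]_n)
    (s : gT -> 'M[F]_m) T :
  proj_rep f p -> proj_rep f s ->
  forall g, p g *m conj_sum_mx p s T = conj_sum_mx p s T *m s g.
Proof.
move=> fp fs g; rewrite mulmx_sumr mulmx_suml [RHS](reindex_inj (mulgI g)) /=.
apply: eq_bigr => x _; rewrite !mulmxA (proj_repM fp) -!scalemxAl -!mulmxA.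
rewrite scalemxAr scalemxAr; do 2 congr (_ *m _).
apply: (can_inj (mulmxK (proj_rep_unit fs x))).
rewrite -mulmxA (proj_repM fs) -scalemxAr -scalemxAl mulVmx ?mulVmx //.
  exact: (proj_rep_unit fs).
exact: (proj_rep_unit fs).
Qed.

(** The matrix of left multiplication by u_g in the basis (u_h). *)
Definition regular_mx (f : gT * gT -> F) (g : gT) : 'M[F]_#|gT| :=
  \matrix_(i, j) (f (g, enum_val j) *+ (enum_val i == (g * enum_val j)%g)).

Lemma regular_proj_rep (f : cocycle F gT) : proj_rep f (regular_mx f).
Proof.
split=> [|g h]; apply/matrixP=> i j; rewrite !mxE.
  by rewrite mul1g (inj_eq enum_val_inj) cocycle1l.
rewrite (bigD1 (enum_rank (h * enum_val j)%g)) //= big1 => [|k kj].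
  rewrite !mxE enum_rankK eqxx mulr1n addr0 mulgA; case: eqP => _ /=.
    by rewrite !mulr1n mulrC -cocycleE.
  by rewrite mul0r mulr0.
rewrite !mxE -(can2_eq enum_valK enum_rankK) in kj *.
by rewrite (negPf kj) mulr0.
Qed.

(** The conclusion of the lemma of Schur, used in place of irreducibility. *)
Definition scalar_commutant n (p : gT -> 'M[F]_n) :=
  forall T, (forall g, T *m p g = p g *m T) -> is_scalar_mx T.

(** A representation of minimal positive degree works: an eigenspace of a matrix
commuting with all p(g) is stable, so by minimality it is the whole space. *)
Lemma exists_scalar_commutant (f : cocycle F gT) :
  exists n (p : gT -> 'M[F]_n),
    [/\ (0 < n)%N, proj_rep f p & scalar_commutant p].
Proof.
pose P n := `[< (0 < n)%N /\ exists p : gT -> 'M[F]_n, proj_rep f p >].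
have exP : exists n, P n.
  exists #|gT|; apply/asboolP; split; first by apply/card_gt0P; exists 1%g.
  by exists (regular_mx f); apply: regular_proj_rep.
case: (ex_minnP exP) => n /asboolP[n0 [p fp]] min_n.
exists n, p; split=> // T Tp.
have [a aT] := spectral.eigenvalue_closed T n0.
(* Matrices act on row vectors: W is the eigenspace, B a basis of it, and q
   the restriction of p to W written in the basis B. *)
pose W := kermx (T - a%:M).
pose B := row_base W; pose q g := B *m p g *m pinvmx B.
have W0 : (0 < \rank W)%N.
  by move: aT; rewrite /eigenvalue /eigenspace -mxrank_eq0 lt0n.
have fB : row_free B by apply: row_base_free.
have qB g : q g *m B = B *m p g.
  apply: mulmxKpV; rewrite (eq_row_base W) /W; apply/sub_kermxP.
  have /sub_kermxP BW : (B <= W)%MS by rewrite eq_row_base.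
  rewrite mulmxBr scalar_mxC -mulmxA -Tp mulmxA [_%:M *m _]mulmxA -scalar_mxC.
  by rewrite -mulmxBl -mulmxBr BW mul0mx.
have Pr : P (\rank W).
  apply/asboolP; split=> //; exists q; split=> [|g h].
    apply: (row_free_inj fB); rewrite qB (proj_rep1 fp).
    exact: scalar_mxC.
  apply: (row_free_inj fB); rewrite -mulmxA qB mulmxA qB -mulmxA (proj_repM fp).
  by rewrite -scalemxAr -scalemxAl qB.
have Wn : \rank W = n by apply/eqP; rewrite eqn_leq rank_leq_row min_n.
apply/is_scalar_mxP; exists a; apply/eqP; rewrite -subr_eq0 -mxrank_eq0.
have := mxrank_ker (T - a%:M); rewrite -/W Wn => /esym.
move/(congr1 (addn^~ (\rank (T - a%:M)))); rewrite subnK ?rank_leq_row //.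
by move/eqP; rewrite -[X in X == _]addn0 eqn_add2l eq_sym.
Qed.

(** The orthogonality relations. By hypothesis conj_sum_mx p p T is scalar, and
taking traces it is |G| / n tr(T); for T running through the elementary matrices
this says how to write any M as a combination of the p(g). *)
Lemma scalar_commutant_spanning (f : cocycle F gT) n (p : gT -> 'M[F]_n) :
  (0 < n)%N -> proj_rep f p -> scalar_commutant p -> spanning p.
Proof.
move=> n0 fp sp M.
have G0 := group_card_neq0 F gT.
have nF0 : n%:R != 0 :> F by rewrite pnatr_eq0 -lt0n.
have avgE T : conj_sum_mx p p T = (#|gT|%:R / n%:R * \tr T)%:M.
  have /is_scalar_mxP[c cE] : is_scalar_mx (conj_sum_mx p p T).
    by apply: sp => g; rewrite (conj_sum_mxP T fp fp).
  rewrite cE; congr (_ %:M); move/(congr1 mxtrace): cE.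
  rewrite mxtrace_scalar linear_sum /=.
  under eq_bigr => g _ do
    rewrite mxtrace_mulC mulmxA mulVmx ?(proj_rep_unit fp) // mul1mx.
  rewrite sumr_const -[LHS]mulr_natr -[RHS]mulr_natr.
  move=> /esym/(canRL (mulfK nF0)) ->.
  by rewrite [RHS]mulrC mulrA.
have tr_delta j k : \tr (delta_mx j k : 'M[F]_n) = (j == k)%:R.
  rewrite /mxtrace (bigD1 j) //= big1 ?addr0 => [|l lj]; rewrite mxE ?eqxx //.
  by rewrite (negPf lj).
exists (fun g => n%:R / #|gT|%:R * \tr (M *m invmx (p g))).
apply/matrixP=> i j; rewrite summxE.
transitivity (n%:R / #|gT|%:R *
   \sum_l \sum_k M l k * (conj_sum_mx p p (delta_mx j k)) i l).
  rewrite (bigD1 i) //= [X in _ + X]big1 ?addr0 => [|l li]; last first.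
    rewrite big1 // => k _.
    by rewrite avgE mxE eq_sym (negPf li) mulr0.
  rewrite (bigD1 j) //= big1 ?addr0 => [|k kj].
    rewrite avgE tr_delta mxE !eqxx mulr1n mulr1 mulrCA -[n%:R / _]invf_div.
    by rewrite mulVf ?mulr1 // mulf_neq0 ?invr_eq0.
  by rewrite avgE tr_delta eq_sym (negPf kj) mulr0 mxE mul0rn mulr0.
under [RHS]eq_bigr => g _ do rewrite mxE -[_ * p _ _ _]mulrA.
rewrite -mulr_sumr; congr (_ * _).
under [RHS]eq_bigr => g _ do rewrite mulr_suml.
rewrite [RHS]exchange_big; apply: eq_bigr => l _ /=.
under [RHS]eq_bigr => g _ do rewrite mxE mulr_suml.
rewrite [RHS]exchange_big; apply: eq_bigr => k _ /=.
rewrite summxE mulr_sumr; apply: eq_bigr => g _.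
by rewrite mulmx_delta_entry -mulrA [p g i j * _]mulrC.
Qed.

Lemma spanning_scalar_commutant n (p : gT -> 'M[F]_n) :
  spanning p -> scalar_commutant p.
Proof.
move=> sp T Tp; have TM M : T *m M = M *m T.
  have [a ->] := sp M; rewrite mulmx_sumr mulmx_suml; apply: eq_bigr => g _.
  by rewrite -scalemxAr -scalemxAl Tp.
case: n T p TM {sp Tp} => [|n] T p TM.
  by apply/is_scalar_mxP; exists 0; apply/matrixP=> [[]].
apply/is_scalar_mxP; exists (T 0 0); apply/matrixP=> i j.
have := congr1 (fun A : 'M_n.+1 => A i 0) (TM (delta_mx j 0)).
have := mulmx_delta_entry T (1%:M : 'M_n.+1) i j 0 0; rewrite mulmx1 => -> /=.
have := mulmx_delta_entry (1%:M : 'M_n.+1) T i j 0 0; rewrite mul1mx => -> /=.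
by rewrite !mxE eqxx mulr1 mulr_natl.
Qed.
End ProjRep.

(** * Twisted group algebras that are matrix algebras *)
Section MatrixAlg.
Variables (F : numClosedFieldType) (gT : finGroupType).
Implicit Type f : cocycle F gT.

Lemma square_card_gt0 n : (n * n)%N = #|gT| -> (0 < n)%N.
Proof.
have : (0 < #|gT|)%N by apply/card_gt0P; exists 1%g.
by move=> + nn; rewrite -nn muln_gt0 => /andP[].
Qed.

Lemma twisted_algE f (a : twisted_alg f) :
  a = \sum_g (a : {ffun gT -> F}) g *: twisted_basis f g.
Proof.
apply/ffunP=> h; rewrite sum_ffunE (bigD1 h) //= big1 => [|g gh].
  by rewrite addr0 !ffunE eqxx [RHS]mulr1.
by rewrite !ffunE eq_sym (negPf gh) scaler0.
Qed.

Lemma spanning_is_matrix_alg f n (p : gT -> 'M[F]_n) :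
  proj_rep f p -> (n * n)%N = #|gT| -> spanning p ->
  is_matrix_alg (twisted_alg f).
Proof.
move=> fp nn sp; have n0 := square_card_gt0 nn.
have ip : lin_indep p by apply/spanning_indep.
case: n => // n in p fp nn sp ip n0 *.
pose phi (a : twisted_alg f) : 'M[F]_n.+1 :=
  \sum_g (a : {ffun gT -> F}) g *: p g.
have phi_lin : linear phi.
  move=> x a b; rewrite /phi scaler_sumr -big_split; apply: eq_bigr => g _ /=.
  by rewrite !ffunE scalerDl scalerA.
have phi_mul : monoid_morphism phi.
  split.
    rewrite /phi (bigD1 1%g) //= big1 => [|g g1].
      rewrite !ffunE eqxx addr0 (proj_rep1 fp) scale_scalar_mx [_ *: _]mulr1.
      by rewrite mulVf // cocycle_neq0.
    by rewrite !ffunE (negPf g1) scaler0 scale0r.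
  move=> a b; rewrite /phi.
  under eq_bigr => g _ do rewrite ffunE scaler_suml.
  rewrite exchange_big mulr_suml; apply: eq_bigr => g _ /=.
  rewrite mulr_sumr (reindex_inj (mulgI g)) /=; apply: eq_bigr => h _.
  rewrite mulKg -[RHS]/((a g *: p g) *m (b h *: p h)) -scalemxAl -scalemxAr.
  by rewrite (proj_repM fp) !scalerA.
pose phiL : {linear twisted_alg f -> 'M[F]_n.+1} :=
  HB.pack phi (GRing.isLinear.Build F _ _ _ phi phi_lin).
pose phiM : {lrmorphism twisted_alg f -> 'M[F]_n.+1} :=
  HB.pack phi phiL (GRing.isMonoidMorphism.Build _ _ phi phi_mul).
have [psi psiE] := choice sp.
exists n, phiM; exists (fun M => [ffun g => psi M g] : twisted_alg f).
  move=> a; apply/ffunP=> g; rewrite ffunE; apply/eqP; rewrite -subr_eq0.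
  apply/eqP; apply: (ip (fun g => psi (phiM a) g - (a : {ffun gT -> F}) g)).
  under eq_bigr => h _ do rewrite scalerBl.
  by rewrite sumrB -psiE subrr.
move=> M; rewrite /= /phi [RHS]psiE; by apply: eq_bigr => g _; rewrite ffunE.
Qed.

(** The sum z of the conjugates of p(g) by all p(x) commutes with a spanning
family, hence is a scalar c, and its trace is |G| tr p(g). Now z is also a
combination of the p(h) for h conjugate to g, so for h != 1, and linear
independence forces c = 0. *)
Lemma trace0_of_basis f n (p : gT -> 'M[F]_n) :
  proj_rep f p -> spanning p -> lin_indep p ->
  forall g, g != 1%g -> \tr (p g) = 0.
Proof.
move=> fp sp ip g g1.
pose z := conj_sum_mx p p (p g).
have /is_scalar_mxP[c zc] : is_scalar_mx z.
  by apply: (spanning_scalar_commutant sp) => h; rewrite (conj_sum_mxP _ fp fp).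
have /eqP : \tr z = \tr (p g) *+ #|gT|.
  rewrite linear_sum -sumr_const; apply: eq_bigr => x _ /=.
  by rewrite mxtrace_mulC mulmxA mulVmx ?(proj_rep_unit fp) // mul1mx.
have c0 : c = 0.
  pose a x := f (x, g) / f ((x * g * x^-1)%g, x).
  have zE : z = \sum_x a x *: p (x * g * x^-1)%g.
    apply: eq_bigr => x _; rewrite (proj_repM fp).
    apply: (can_inj (mulmxK (proj_rep_unit fp x))).
    rewrite mulmxKV ?(proj_rep_unit fp) // -scalemxAl (proj_repM fp).
    by rewrite mulgKV scalerA /a mulfVK // cocycle_neq0.
  (* The coefficients of z - c in the basis p. *)
  pose b x := \sum_(y | (y * g * y^-1)%g == x) a y -
              (x == 1%g)%:R * c / f (1%g, 1%g).
  have := ip b; have -> : \sum_x b x *: p x = 0.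
    under eq_bigr => x _ do rewrite scalerBl.
    rewrite sumrB [X in _ - X](bigD1 1%g) //= (big1 _ (fun x => x != 1%g)).
      rewrite eqxx mul1r (proj_rep1 fp) scale_scalar_mx mulfVK ?cocycle_neq0 //.
      rewrite addr0 -zc zE; apply/eqP; rewrite subr_eq0; apply/eqP.
      rewrite [RHS](partition_big (fun x => (x * g * x^-1)%g) predT) //=.
      apply: eq_bigr => x _; rewrite scaler_suml.
      by apply: eq_bigr => y /eqP->.
    by move=> x /negPf->; rewrite !mul0r scale0r.
  move=> /(_ erefl 1%g); rewrite /b eqxx big_pred0 => [|y].
    rewrite sub0r mul1r => /eqP; rewrite oppr_eq0 mulf_eq0 invr_eq0.
    by rewrite (negPf (cocycle_neq0 _ _ _)) orbF => /eqP.
  by rewrite -eq_mulgV1 -[X in _ == X]mulg1 (inj_eq (mulgI y)) (negPf g1).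
rewrite zc c0 mxtrace_scalar mul0rn eq_sym -mulr_natr mulf_eq0.
by rewrite (negPf (group_card_neq0 F gT)) orbF => /eqP.
Qed.

(** The vanishing of traces passes to restrictions and to tensor products: this
is what makes non-degeneracy in this form tractable on semidirect products. *)
Lemma is_matrix_algP f :
  is_matrix_alg (twisted_alg f) <->
  exists n (p : gT -> 'M[F]_n),
    [/\ proj_rep f p, (n * n)%N = #|gT| & forall g, g != 1%g -> \tr (p g) = 0].
Proof.
split=> [[n [phi [psi phiK psiK]]] | [n [p [fp nn tr0]]]]; last first.
  apply: (spanning_is_matrix_alg fp nn); apply/spanning_indep => //.
  by apply: (proj_rep_trace_indep fp) tr0; apply: square_card_gt0 nn.
pose u := twisted_basis f; pose p g := phi (u g).
have phiE (a : twisted_alg f) : phi a = \sum_g (a : {ffun gT -> F}) g *: p g.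
  rewrite {1}[a]twisted_algE linear_sum.
  by apply: eq_bigr => g _; rewrite linearZ.
have u1 : u 1%g = f (1%g, 1%g) *: 1.
  by rewrite scalerA mulfV ?scale1r // cocycle_neq0.
have fp : proj_rep f p.
  split=> [|g h]; first by rewrite /p u1 linearZ rmorph1; apply: scalemx1.
  by rewrite -[_ *m _]rmorphM -linearZ twisted_basisM.
have sp : spanning p.
  by move=> M; exists (psi M : {ffun gT -> F}); rewrite -phiE psiK.
have ip : lin_indep p.
  move=> a a0 g; have : phi ([ffun g => a g] : {ffun gT -> F}) = 0.
    by rewrite phiE -[RHS]a0; apply: eq_bigr => h _; rewrite ffunE.
  by rewrite -[RHS](linear0 phi) => /(can_inj phiK)/ffunP/(_ g); rewrite !ffunE.
exists n.+1, p; split=> // [|g g1]; first exact: spanning_indep_card sp ip.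
exact: (trace0_of_basis fp).
Qed.

(** A family multiplicative up to scalars yields its own cocycle: the cocycle
identity is associativity of the matrix product. *)
Lemma central_type_rep n (p : gT -> 'M[F]_n) :
  (n * n)%N = #|gT| -> (forall g, p g \in unitmx) ->
  (forall g h, exists2 c, c != 0 & p g *m p h = c *: p (g * h)%g) ->
  (forall g, g != 1%g -> \tr (p g) = 0) -> central_type F gT.
Proof.
move=> nn pU pM tr0; have n0 := square_card_gt0 nn.
have pM' (gh : gT * gT) :
    exists c, c != 0 /\ p gh.1 *m p gh.2 = c *: p (gh.1 * gh.2)%g.
  by have [c] := pM gh.1 gh.2; exists c.
have {pM pM'}[c cE] := choice pM'.
have cP : is_cocycle [ffun gh => c gh].
  apply/andP; split.
    by apply/forallP=> g; apply/forallP=> h; rewrite ffunE; case: (cE (g, h)).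
  apply/forallP=> g; apply/forallP=> h; apply/forallP=> k; rewrite !ffunE.
  have := mulmxA (p g) (p h) (p k).
  have /= -> := (cE (g, h)).2; have /= -> := (cE (h, k)).2.
  rewrite -scalemxAr -scalemxAl.
  have /= -> := (cE (g, h * k)%g).2; have /= -> := (cE (g * h, k)%g).2.
  rewrite !scalerA mulgA => /(scale_unitmx_inj n0 (pU _)) e.
  by apply/eqP.
exists (coh_class (Cocycle cP)); apply/nondegenerateE/is_matrix_algP.
exists n, p; split=> //; split=> [|g h]; rewrite ffunE.
  2: exact: (cE (g, h)).2.
have /= := (cE (1, 1)%g).2; rewrite mulg1 => p11.
by apply: (can_inj (mulKmx (pU 1%g))); rewrite p11 mul_mx_scalar.
Qed.

Lemma exists_spanning f :
  exists n (p : gT -> 'M[F]_n), [/\ (0 < n)%N, proj_rep f p & spanning p].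
Proof.
have [n [p [n0 fp sp]]] := exists_scalar_commutant f.
have := scalar_commutant_spanning n0 fp sp.
by exists n, p.
Qed.

End MatrixAlg.

(** * Intertwiners *)
Lemma mxtrace_idem (F : fieldType) n (P : 'M[F]_n) :
  P *m P = P -> \tr P = (\rank P)%:R.
Proof.
move=> PP; have := mulmx_base P; have := row_base_free P.
have := col_base_full P; move: (col_base P) (row_base P) => A B fA fB AB.
rewrite -{1}AB mxtrace_mulC -mxtrace1; congr mxtrace.
apply: (row_free_inj fB); rewrite mul1mx; apply: (row_full_inj fA).
by rewrite !mulmxA AB -mulmxA AB PP.
Qed.

Lemma mxtrace_lin_mx (F : fieldType) m n
    (h : {linear 'M[F]_(m, n) -> 'M_(m, n)}) :
  \tr (lin_mx h) = \sum_i \sum_j h (delta_mx i j) i j.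
Proof.
rewrite /mxtrace pair_bigA.
rewrite (reindex (uncurry (@mxvec_index m n))) /=; last first.
  exact: curry_mxvec_bij.
apply: eq_bigr => [[i j]] _ /=.
rewrite -[in RHS](mxvecK (delta_mx i j)) -[h _]mx_vec_lin mxvecK.
by rewrite mxvec_delta -rowE !mxE.
Qed.

Section Intertwiners.
Variables (F : numClosedFieldType) (gT : finGroupType) (f : cocycle F gT).
Variables (d w : nat) (p : gT -> 'M[F]_d) (s : gT -> 'M[F]_w).
Hypotheses (fp : proj_rep f p) (fs : proj_rep f s).

Lemma conj_sum_mx_linear : linear (conj_sum_mx p s).
Proof.
move=> a A B; rewrite /conj_sum_mx scaler_sumr -big_split.
by apply: eq_bigr => g _ /=; rewrite mulmxDr mulmxDl -scalemxAr -scalemxAl.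
Qed.

HB.instance Definition _ :=
  GRing.isLinear.Build F _ _ _ (conj_sum_mx p s) conj_sum_mx_linear.

Lemma conj_sum_mx_idem T :
  conj_sum_mx p s (conj_sum_mx p s T) = #|gT|%:R *: conj_sum_mx p s T.
Proof.
rewrite {1}/conj_sum_mx scaler_nat -sumr_const; apply: eq_bigr => g _.
by rewrite (conj_sum_mxP _ fp fs) mulmxK // (proj_rep_unit fs).
Qed.

Hypothesis tr0 : forall g, g != 1%g -> \tr (p g) = 0.

Lemma mxtrace_conj_sum_mx : \tr (lin_mx (conj_sum_mx p s)) = (d * w)%:R.
Proof.
rewrite mxtrace_lin_mx.
transitivity (\sum_g \tr (p g) * \tr (invmx (s g))).
  under eq_bigr => i _ do under eq_bigr => j _ do rewrite summxE.
  under eq_bigr => i _ do rewrite exchange_big /=.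
  rewrite exchange_big; apply: eq_bigr => g _ /=.
  rewrite mulr_suml; apply: eq_bigr => i _.
  by rewrite mulr_sumr; apply: eq_bigr => j _; rewrite mulmx_delta_entry.
rewrite (bigD1 1%g) //= big1 => [|g g1]; last by rewrite tr0 // mul0r.
rewrite addr0 (proj_rep1 fp) (proj_rep1 fs) invmx_scalar !mxtrace_scalar.
by rewrite mulrnAl mulrnAr -mulrnA mulfV ?cocycle_neq0 1?mulnC.
Qed.

(** The intertwiners from s to p form a space of dimension d w / |G|: the
trace of the projector onto it is its rank. *)
Lemma dvdn_card_degree : (#|gT| %| d * w)%N.
Proof.
have G0 := group_card_neq0 F gT.
pose P := #|gT|%:R^-1 *: lin_mx (conj_sum_mx p s).
have PP : P *m P = P.
  apply/row_matrixP=> i; rewrite !rowE; move: (delta_mx _ _) => v.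
  rewrite mulmxA -[v]vec_mxK /P -!scalemxAr -scalemxAl !mul_vec_lin /=.
  by rewrite conj_sum_mx_idem [mxvec (_ *: _)]linearZ /= !scalerA mulfVK.
have /eqP := mxtrace_idem PP; rewrite linearZ /= mxtrace_conj_sum_mx.
rewrite mulrC (can2_eq (mulfVK G0) (mulfK G0)) -natrM eqr_nat => /eqP->.
exact: dvdn_mull.
Qed.

Lemma exists_intertwiner : (0 < d)%N -> (0 < w)%N ->
  exists2 T : 'M_(d, w), T != 0 & forall g, p g *m T = T *m s g.
Proof.
move=> d0 w0; apply: contrapT => noT.
have avg0 T : conj_sum_mx p s T = 0.
  apply: contrapT => /eqP T0; case: noT; exists (conj_sum_mx p s T) => //.
  by move=> g; rewrite (conj_sum_mxP _ fp fs).
have := mxtrace_conj_sum_mx; rewrite mxtrace_lin_mx big1 => [/esym/eqP|i _].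
  by rewrite pnatr_eq0 muln_eq0 -leqn0 leqNgt d0 -leqn0 leqNgt w0.
by rewrite big1 // => j _; rewrite -[LHS]/(conj_sum_mx p s _ i j) avg0 mxE.
Qed.

End Intertwiners.

(** * Restriction to a Hall subgroup *)
Section Pullback.
Variables (F : fieldType) (hT gT : finGroupType) (h : hT -> gT).
Hypothesis hM : {morph h : x y / (x * y)%g}.

Lemma pullback_subproof (f : cocycle F gT) :
  is_cocycle [ffun xy : hT * hT => f (h xy.1, h xy.2)].
Proof.
apply/andP; split.
  by apply/forallP=> x; apply/forallP=> y; rewrite ffunE cocycle_neq0.
apply/forallP=> x; apply/forallP=> y; apply/forallP=> z.
by rewrite !ffunE /= !hM cocycleE.
Qed.

Definition pullback f := Cocycle (pullback_subproof f).

Lemma pullbackE f x y : pullback f (x, y) = f (h x, h y).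
Proof. by rewrite ffunE. Qed.

End Pullback.

Section PullbackRep.
Variables (F : numClosedFieldType) (hT gT : finGroupType) (h : hT -> gT).
Hypothesis hM : {morph h : x y / (x * y)%g}.

Lemma morph1g : h 1%g = 1%g.
Proof. by apply: (mulgI (h 1%g)); rewrite -hM !mulg1. Qed.

Lemma pullback_rep (f : cocycle F gT) n (p : gT -> 'M[F]_n) :
  proj_rep f p -> proj_rep (pullback hM f) (p \o h).
Proof.
move=> [p1 pM]; split=> [|x y]; first by rewrite pullbackE /= morph1g.
by rewrite pullbackE /= pM hM.
Qed.

(** With H the image of h, |H| divides d w where d^2 = |H| m, so |H|^2 divides
|H| m w^2 and, by coprimality, |H| divides w^2. Since w^2 <= |H|, equality
holds. *)
Lemma hall_nondegenerate (f : cocycle F gT) m :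
  injective h -> #|gT| = (#|hT| * m)%N -> coprime #|hT| m ->
  is_matrix_alg (twisted_alg f) -> is_matrix_alg (twisted_alg (pullback hM f)).
Proof.
move=> hI cardG co_m /is_matrix_algP[d [p [fp dd tr0]]].
have [w [s [w0 fs sp]]] := exists_spanning (pullback hM f).
have ww : (w * w <= #|hT|)%N := spanning_le sp.
apply: (spanning_is_matrix_alg fs _ sp); apply/eqP; rewrite eqn_leq ww.
have /(dvdn_card_degree (pullback_rep fp) fs) dvd_dw x :
    x != 1%g -> \tr (p (h x)) = 0.
  by move=> x1; apply: tr0; rewrite -morph1g (inj_eq hI).
apply: dvdn_leq; first by rewrite muln_gt0 w0.
rewrite -(Gauss_dvdr _ co_m) -(@dvdn_pmul2l #|hT|) ?mulnA -?cardG -?dd.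
  by rewrite -[(_ * w * w)%N]mulnA mulnACA; apply: dvdn_mul.
by apply/card_gt0P; exists 1%g.
Qed.

End PullbackRep.

(** * Cohomologous cocycles, tensor products and equivalences *)
Lemma rep_cohomologous (F : numClosedFieldType) (gT : finGroupType)
    (f f' : cocycle F gT) n (p q : gT -> 'M[F]_n) :
  (0 < n)%N -> proj_rep f p -> proj_rep f' q ->
  (forall g, exists2 c, c != 0 & q g = c *: p g) -> cohomologous f f'.
Proof.
move=> n0 fp f'q qp.
have qp' g : exists c, c != 0 /\ q g = c *: p g by have [c] := qp g; exists c.
have {qp qp'}[b bE] := choice qp'.
exists [ffun g => b g] => [g|g h]; rewrite !ffunE; first by case: (bE g).
have := proj_repM f'q g h; rewrite !(bE _).2 -scalemxAl -scalemxAr.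
rewrite (proj_repM fp) !scalerA.
move=> /(scale_unitmx_inj n0 (proj_rep_unit fp _)) bf.
by apply: (mulIf (bE (g * h)%g).1); rewrite -bf mulrA mulfVK ?(bE _).1 // mulrC.
Qed.

Section Kron.
Variables (F : fieldType) (n r : nat).
Implicit Types (A C : 'M[F]_n) (B D : 'M[F]_r).

(** The Kronecker product, realized as T |-> A^T T B on n x r matrices; the
transpose makes it multiplicative in A, as matrices act on row vectors. *)
Definition kron A B : 'M_(n * r) := lin_mx (mulmxr B \o mulmx A^T).

Lemma vec_mul_kron A B T : mxvec T *m kron A B = mxvec (A^T *m T *m B).
Proof. by rewrite mul_vec_lin. Qed.

Lemma kronM A B C D : kron A B *m kron C D = kron (A *m C) (B *m D).
Proof.
apply/row_matrixP=> i; rewrite !rowE; move: (delta_mx _ _) => v.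
by rewrite -[v]vec_mxK mulmxA !vec_mul_kron trmx_mul !mulmxA.
Qed.

Lemma kronZ a b A B : kron (a *: A) (b *: B) = (a * b) *: kron A B.
Proof.
apply/row_matrixP=> i; rewrite !rowE; move: (delta_mx _ _) => v.
rewrite -[v]vec_mxK -scalemxAr !vec_mul_kron -[in RHS]linearZ; congr mxvec.
by rewrite [(_ *: A)^T]linearZ /= -!scalemxAl -scalemxAr scalerA.
Qed.

Lemma kron1 : kron 1%:M 1%:M = 1%:M.
Proof.
apply/row_matrixP=> i; rewrite !rowE; move: (delta_mx _ _) => v.
by rewrite -[v]vec_mxK vec_mul_kron trmx1 mul1mx !mulmx1.
Qed.

Lemma mxtrace_kron A B : \tr (kron A B) = \tr A * \tr B.
Proof.
rewrite mxtrace_lin_mx mulr_suml; apply: eq_bigr => i _.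
rewrite mulr_sumr; apply: eq_bigr => j _ /=.
by rewrite mulmx_delta_entry mxE.
Qed.

Lemma kron_unit A B : A \in unitmx -> B \in unitmx -> kron A B \in unitmx.
Proof.
move=> uA uB; have /mulmx1_unit[] // :
    kron A B *m kron (invmx A) (invmx B) = 1%:M.
by rewrite kronM !mulmxV // kron1.
Qed.

End Kron.

Section IrreducibleIntertwiners.
Variables (F : numClosedFieldType) (gT : finGroupType) (n : nat).
Variables (p s : gT -> 'M[F]_n) (T : 'M[F]_n).
Hypothesis sp : spanning p.
Hypothesis pT : forall g, p g *m T = T *m s g.

(** The row kernel of T is stable under p, hence under all matrices, so it is
trivial unless T = 0. *)
Lemma intertwiner_unit : T != 0 -> T \in unitmx.
Proof.
move=> T0; rewrite -row_free_unit -kermx_eq0.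
have kerM M : kermx T *m M *m T = 0.
  have [a ->] := sp M; rewrite mulmx_sumr mulmx_suml big1 // => g _.
  by rewrite -scalemxAr -scalemxAl -mulmxA pT mulmxA mulmx_ker mul0mx scaler0.
apply/eqP/matrixP=> i j; rewrite [RHS]mxE; apply/eqP; apply: contraNT T0 => kij.
apply/eqP/matrixP=> k l; rewrite [RHS]mxE.
have := mulmx_delta_entry (kermx T) T i j k l; rewrite kerM mxE => /esym/eqP.
by rewrite mulf_eq0 (negPf kij) => /eqP.
Qed.

End IrreducibleIntertwiners.

(** * Coprime actions and semidirect products *)
Section Action.
Variables (F : numClosedFieldType) (N K : finGroupType).
Variable eta : groupAction [set: K] [set: N].
Implicit Type f : cocycle F N.

Lemma act_morphM k : {morph (eta ^~ k) : x y / (x * y)%g}.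
Proof. by move=> x y; apply: gactM; rewrite inE. Qed.

Definition act_cocycle k : cocycle F N -> cocycle F N :=
  pullback (act_morphM k).

(** Restates invariance of a class in terms of representing cocycles. The
inverse in the action of automorphisms on cocycles disappears because k ranges
over a group. *)
Lemma symplecticP :
  symplectic F eta <->
  exists2 f : cocycle F N, is_matrix_alg (twisted_alg f) &
    forall k, cohomologous f (act_cocycle k f).
Proof.
have phiA k : actperm eta k \in Aut [set: N] by apply: actperm_Aut; rewrite inE.
have aut_act k f : aut_cocycle (actperm eta k^-1) f = act_cocycle k f.
  apply/val_inj/ffunP=> [[x y]].
  rewrite -[RHS]/(act_cocycle k f (x, y)) pullbackE.
  have := aut_cocycleE f x y (phiA k^-1%g).
  by rewrite -morphV ?inE // invgK !actpermE.
split=> [[c [f <- fM] /subsetP etaSp] | [f fM etaf]].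
  exists f => // k; apply: cohomologous_sym; apply/coh_classP.
  have : actperm eta k^-1 \in Sp (coh_class f).
    by apply: etaSp; apply: mem_morphim; rewrite inE.
  by rewrite inE aut_H2E ?phiA // aut_act => /andP[_ /eqP].
exists (coh_class f); first exact/nondegenerateE.
apply/subsetP=> _ /morphimP[k _ _ ->]; rewrite inE phiA aut_H2E //=.
rewrite -[k]invgK aut_act; apply/eqP/coh_classP; exact: cohomologous_sym.
Qed.

(** The class of f has order dividing |N|: multiply the cocycle identity over
its third variable. *)
Lemma cocycle_expr_card f :
  exists2 b : N -> F, (forall x, b x != 0) &
    forall x y, f (x, y) ^+ #|N| = b x * b y / b (x * y)%g.
Proof.
exists (fun x => \prod_z f (x, z)) => [x|x y].
  by apply/prodf_neq0 => z _; apply: cocycle_neq0.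
apply/esym/(canLR (mulfK _)).
  by apply/prodf_neq0 => z _; apply: cocycle_neq0.
rewrite -prodr_const -[RHS]big_split /= [in LHS](reindex_inj (mulgI y)) /=.
rewrite -big_split; apply: eq_bigr => z _ /=.
by rewrite cocycleE mulrC.
Qed.

(** The product of the K-translates of f is invariant, and cohomologous to
f^|K|. Raise it to a power u with u |K| = q |N| + 1: as f^|N| is a
coboundary, the result is cohomologous to f. *)
Lemma invariant_cocycle f :
  coprime #|N| #|K| -> (forall k, cohomologous f (act_cocycle k f)) ->
  exists2 f', cohomologous f f' &
    forall k x y, f' (eta x k, eta y k) = f' (x, y).
Proof.
move=> co_NK etaf.
have exb k : exists b : N -> F, (forall x, b x != 0) /\
    forall x y, f (eta x k, eta y k) = f (x, y) * (b x * b y / b (x * y)%g).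
  have [b b0 bE] := etaf k.
  by exists b; split=> // x y; rewrite -bE pullbackE.
have [b bE] := choice exb.
have [d d0 dE] := cocycle_expr_card f.
have K0 : (0 < #|K|)%N by apply/card_gt0P; exists 1%g.
have [u q uq _] := egcdnP #|N| K0.
have {}uq : (u * #|K| = q * #|N| + 1)%N.
  by move: uq; rewrite gcdnC (eqP co_NK).
have prodK_act (c : N * N -> F) k x y :
    \prod_l c (eta (eta x k) l, eta (eta y k) l) = \prod_l c (eta x l, eta y l).
  rewrite [RHS](reindex_inj (mulgI k)) /=; apply: eq_bigr => l _.
  by rewrite !actMin ?inE.
have f'P : is_cocycle
    [ffun xy : N * N => (\prod_k f (eta xy.1 k, eta xy.2 k)) ^+ u].
  apply/andP; split.
    apply/forallP=> x; apply/forallP=> y; rewrite ffunE expf_neq0 //.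
    by apply/prodf_neq0 => k _; apply: cocycle_neq0.
  apply/forallP=> x; apply/forallP=> y; apply/forallP=> z; rewrite !ffunE /=.
  rewrite -!exprMn -!big_split /=; apply/eqP; congr (_ ^+ u).
  by apply: eq_bigr => k _; rewrite !act_morphM cocycleE.
exists (Cocycle f'P); last by move=> k x y; rewrite !ffunE /= prodK_act.
exists [ffun x => (\prod_k b k x) ^+ u * d x ^+ q] => [x|x y].
  rewrite ffunE mulf_neq0 ?expf_neq0 //.
  by apply/prodf_neq0 => k _; case: (bE k).
rewrite !ffunE /=.
under eq_bigr => k _ do rewrite (bE k).2.
rewrite !big_split prodr_const /= prodfV !exprMn -exprM [(#|_| * u)%N]mulnC uq.
rewrite addn1 exprSr mulnC exprM dE !exprMn !exprVn.
set B1 := _ ^+ u; set B2 := _ ^+ u; set B3 := _ ^+ u.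
have B30 : B3 != 0.
  by rewrite expf_neq0 //; apply/prodf_neq0 => k _; case: (bE k).
field. by rewrite B30 expf_neq0.
Qed.

Lemma sdpair1M : {morph sdpair1 eta : x y / (x * y)%g}.
Proof. by move=> x y; apply: sdpair1_morphM; rewrite inE. Qed.

Lemma sdpair2M : {morph sdpair2 eta : x y / (x * y)%g}.
Proof. by move=> x y; apply: sdpair2_morphM; rewrite inE. Qed.

Lemma card_sdprod_by : #|sdprod_by eta| = (#|N| * #|K|)%N.
Proof.
rewrite -cardsT -(sdprod_card (sdprod_sdpair eta)).
by rewrite !card_injm ?injm_sdpair1 ?injm_sdpair2 // !cardsT.
Qed.

(** Conjugating the restriction to N of a representation p by p(k) gives another
representation of the same cocycle, which agrees up to scalars with p composed
with the action of k on N. *)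
Lemma sdprod_restr_invariant (f : cocycle F (sdprod_by eta)) k :
  cohomologous (pullback sdpair1M f) (act_cocycle k (pullback sdpair1M f)).
Proof.
have [n [p [n0 fp _]]] := exists_spanning f.
have fNp := pullback_rep sdpair1M fp.
set kk := sdpair2 eta k; have kU := proj_rep_unit fp kk.
pose q x := invmx (p kk) *m p (sdpair1 eta x) *m p kk.
have fq : proj_rep (pullback sdpair1M f) q.
  split=> [|x y].
    by rewrite /q; have [/= -> _] := fNp; rewrite -mulmxA -scalar_mxC mulKmx.
  have [_ /(_ x y)/= fNM] := fNp.
  rewrite scalemxAl scalemxAr -fNM /q -!mulmxA; do 2 congr (_ *m _).
  by rewrite mulKVmx.
apply: (rep_cohomologous n0 fq (pullback_rep (act_morphM k) fNp)) => x.
set y := sdpair1 eta x.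
exists (f (kk, (y ^ kk)%g) / f (y, kk)) => [|/=].
  by rewrite mulf_neq0 ?invr_eq0 ?cocycle_neq0.
rewrite sdpair_act ?inE // -/y -/kk /q -mulmxA (proj_repM fp) -/y.
rewrite -[in RHS]scalemxAr scalerA mulfVK ?cocycle_neq0 // conjgC.
by rewrite scalemxAr -(proj_repM fp) mulKmx.
Qed.

End Action.

Section SemidirectCentralType.
Variables (F : numClosedFieldType) (N K : finGroupType).
Variable eta : groupAction [set: K] [set: N].
Hypothesis co_NK : coprime #|N| #|K|.

Lemma central_type_sdprod_factors :
  central_type F (sdprod_by eta) ->
  [/\ central_type F N, central_type F K & symplectic F eta].
Proof.
case=> _ [f _ fM].
have fNM : is_matrix_alg (twisted_alg (pullback (sdpair1M eta) f)).
  apply: hall_nondegenerate (card_sdprod_by eta) co_NK fM => x y.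
  by move/(injmP (injm_sdpair1 eta)); apply; rewrite inE.
have fKM : is_matrix_alg (twisted_alg (pullback (sdpair2M eta) f)).
  apply: (@hall_nondegenerate _ _ _ _ _ _ #|N|) fM.
  - by move=> x y /(injmP (injm_sdpair2 eta)); apply; rewrite inE.
  - by rewrite card_sdprod_by mulnC.
  - by rewrite coprime_sym.
split.
- by exists (coh_class (pullback (sdpair1M eta) f)); apply/nondegenerateE.
- by exists (coh_class (pullback (sdpair2M eta) f)); apply/nondegenerateE.
apply/symplecticP; exists (pullback (sdpair1M eta) f) => // k.
exact: sdprod_restr_invariant.
Qed.

(** Choosing f on N invariant as a cocycle makes p and its translates
representations of the same f, so that intertwiners T_k between them exist and
are unique up to a scalar; they need not form a linear representation of K,
since the scalars are absorbed in the cocycle read off from P. *)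
Lemma sdprod_central_type :
  central_type F K -> symplectic F eta -> central_type F (sdprod_by eta).
Proof.
move=> [_ [fK _ /is_matrix_algP[r [s [fs rr trs]]]]] /symplecticP[f0 f0M f0K].
have [f f0f fK_inv] := invariant_cocycle co_NK f0K.
have /is_matrix_algP[n [p [fp nn trp]]] := twisted_alg_cohomologous f0f f0M.
have n0 := square_card_gt0 nn.
have sp : spanning p.
  by apply/spanning_indep => //; apply: (proj_rep_trace_indep fp).
have fpk k : proj_rep f (p \o eta ^~ k).
  split=> [|x y] /=; first by rewrite gact1 ?inE // (proj_rep1 fp).
  by rewrite (proj_repM fp) fK_inv act_morphM.
have exT k : exists T, T \in unitmx /\ forall x, p x *m T = T *m p (eta x k).
  have [T T0 pT] := exists_intertwiner fp (fpk k) trp n0 n0.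
  by exists T; split=> //; apply: intertwiner_unit sp pT T0.
have [T TE] := choice exT.
have TU k : T k \in unitmx by case: (TE k).
have pT k x : p x *m T k = T k *m p (eta x k) by case: (TE k).
have TM k l : exists2 c, c != 0 & T k *m T l = c *: T (k * l)%g.
  have /is_scalar_mxP[c cE] : is_scalar_mx (T k *m T l *m invmx (T (k * l)%g)).
    apply: (spanning_scalar_commutant sp) => x.
    rewrite !mulmxA pT -[T k *m _ *m T l]mulmxA pT mulmxA.
    rewrite -!mulmxA; do 2 congr (_ *m _).
    apply: (can_inj (mulKmx (TU (k * l)%g))).
    by rewrite mulKVmx // mulmxA -actMin ?inE // -pT mulmxK.
  have TkE : T k *m T l = c *: T (k * l)%g.
    by rewrite -mul_scalar_mx -cE mulmxKV.
  exists c => //; apply/eqP => c0; have : T k *m T l \in unitmx.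
    by rewrite unitmx_mul !TU.
  by rewrite TkE c0 scale0r => /(unitmx_neq0 n0); rewrite eqxx.
pose P (g : sdprod_by eta) := kron (T g.1 *m p g.2) (s g.1).
apply: (@central_type_rep _ _ _ P).
- by rewrite mulnACA nn rr card_sdprod_by.
- move=> g; apply: kron_unit; last exact: (proj_rep_unit fs).
  by rewrite unitmx_mul TU (proj_rep_unit fp).
- move=> g h; have [c c0 cE] := TM g.1 h.1.
  exists ((c * f (eta g.2 h.1, h.2)) * fK (g.1, h.1)).
    by rewrite !mulf_neq0 ?cocycle_neq0.
  rewrite kronM -kronZ; congr kron; last by rewrite (proj_repM fs).
  rewrite mulmxA -[T g.1 *m p _ *m _]mulmxA pT mulmxA cE -mulmxA (proj_repM fp).
  by rewrite -scalemxAr -scalemxAl scalerA mulrC.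
(* If the component in K is nontrivial, s has trace 0; otherwise the component
   x in N is nontrivial and T_1 is scalar, so T_1 p(x) has trace 0. *)
move=> g g1; rewrite mxtrace_kron.
have [gK|gK] := eqVneq g.1 1%g; last by rewrite trs // mulr0.
have gN : g.2 != 1%g.
  apply: contra g1 => /eqP gN; apply/eqP/val_inj.
  by move: gK gN; case: (g) => [[]] /= ? ? _ -> ->.
have [c c0 T1] := TM 1%g 1%g.
have {}T1 : T 1%g = c%:M.
  apply: (can_inj (mulKmx (TU 1%g))).
  by rewrite T1 mulg1 mul_mx_scalar.
by rewrite gK T1 mul_scalar_mx linearZ /= trp // mulr0 mul0r.
Qed.

End SemidirectCentralType.

(** * The commutation pairing of an abelian group *)
Section AbelianPairing.
Variables (F : numClosedFieldType) (gT : finGroupType).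
Hypothesis abelG : forall x y : gT, (x * y = y * x)%g.
Implicit Type f : cocycle F gT.

Definition comm_pairing f (x y : gT) := f (x, y) / f (y, x).

Lemma comm_pairing_neq0 f x y : comm_pairing f x y != 0.
Proof. by rewrite mulf_neq0 ?invr_eq0 ?cocycle_neq0. Qed.

Lemma comm_pairingC f x y : comm_pairing f x y = (comm_pairing f y x)^-1.
Proof. by rewrite invf_div. Qed.

Lemma comm_pairing_rep f n (p : gT -> 'M[F]_n) : proj_rep f p ->
  forall x y, p x *m p y = comm_pairing f x y *: (p y *m p x).
Proof.
move=> fp x y; rewrite !(proj_repM fp) scalerA mulfVK ?cocycle_neq0 //.
by rewrite abelG.
Qed.

(** Move p(z) past p(x) p(y) in one step or in two. *)
Lemma comm_pairingMl f x y z :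
  comm_pairing f (x * y)%g z = comm_pairing f x z * comm_pairing f y z.
Proof.
have [n [p [n0 fp _]]] := exists_spanning f.
apply: (scale_unitmx_inj n0 (proj_rep_unit fp (z * (x * y))%g)).
apply: (scalerI (cocycle_neq0 f z (x * y)%g)).
apply: (scalerI (cocycle_neq0 f x y)).
rewrite !scalerA.
transitivity (p x *m p y *m p z).
  rewrite (proj_repM fp x) -scalemxAl (comm_pairing_rep fp) (proj_repM fp z).
  by rewrite !scalerA; congr (_ *: _); ring.
rewrite -mulmxA (comm_pairing_rep fp y) -scalemxAr mulmxA.
rewrite (comm_pairing_rep fp x).
rewrite -scalemxAl scalerA -mulmxA (proj_repM fp x) -scalemxAr scalerA.
rewrite (proj_repM fp z) scalerA; congr (_ *: _); ring.
Qed.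

Lemma comm_pairing1l f z : comm_pairing f 1%g z = 1.
Proof. by rewrite /comm_pairing cocycle1l cocycle1r mulfV // cocycle_neq0. Qed.

Lemma comm_pairingXl f x z i :
  comm_pairing f (x ^+ i)%g z = comm_pairing f x z ^+ i.
Proof.
elim: i => [|i IH]; first by rewrite expg0 comm_pairing1l.
by rewrite expgS comm_pairingMl // IH exprS.
Qed.

Lemma comm_pairing_gen f x y i j k l :
  comm_pairing f (x ^+ i * y ^+ j)%g (x ^+ k * y ^+ l)%g =
  comm_pairing f x y ^+ (i * l) / comm_pairing f x y ^+ (j * k).
Proof.
have gen z a b : comm_pairing f (x ^+ a * y ^+ b)%g z =
    comm_pairing f x z ^+ a * comm_pairing f y z ^+ b.
  by rewrite comm_pairingMl // !comm_pairingXl.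
have e1 z : comm_pairing f z z = 1.
  by rewrite /comm_pairing mulfV // cocycle_neq0.
rewrite gen [comm_pairing f x (_ * _)%g]comm_pairingC.
rewrite [comm_pairing f y (_ * _)%g]comm_pairingC !gen !e1 !expr1n mul1r mulr1.
rewrite [comm_pairing f y x]comm_pairingC !exprVn invrK -!exprM.
by rewrite mulnC [(k * j)%N]mulnC.
Qed.

(** If the pairings agree, f' / f is symmetric, so the members of a
representation of it commute; when its commutant is scalar, they are scalars
b(g), and b trivializes f' / f. *)
Lemma cohomologous_comm_pairing f f' :
  cohomologous f f' <-> (forall x y, comm_pairing f x y = comm_pairing f' x y).
Proof.
split=> [[b b0 bE] x y|ff'].
  rewrite /comm_pairing !bE abelG; field.
  by rewrite !b0 !cocycle_neq0.
have cP : is_cocycle [ffun xy => f' xy / f xy].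
  apply/andP; split.
    apply/forallP=> x; apply/forallP=> y; rewrite ffunE.
    by rewrite mulf_neq0 ?invr_eq0 ?cocycle_neq0.
  apply/forallP=> x; apply/forallP=> y; apply/forallP=> z; rewrite !ffunE.
  by rewrite mulrACA -invfM !cocycleE mulf_div.
pose c := Cocycle cP.
have [n [p [n0 cp pS]]] := exists_scalar_commutant c.
have cC x y : c (x, y) = c (y, x).
  rewrite !ffunE; apply/eqP; rewrite eqr_div ?cocycle_neq0 //.
  have /eqP := ff' x y; rewrite eqr_div ?cocycle_neq0 //.
  by move=> /eqP e; rewrite -e mulrC.
have pC g h : p g *m p h = p h *m p g.
  by rewrite !(proj_repM cp) cC abelG.
have exb g : exists b, p g = b%:M by apply/is_scalar_mxP/pS => h; apply: pC.
have [b bE] := choice exb.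
have b0 g : b g != 0.
  apply: contraTneq (unitmx_neq0 n0 (proj_rep_unit cp g)) => bg.
  by rewrite bE bg -scalemx1 scale0r eqxx.
exists [ffun g => b g] => [g|g h]; rewrite !ffunE //.
have := proj_repM cp g h; rewrite !bE -scalar_mxM -[(b g * _)%:M]scalemx1.
rewrite -[(b (g * h)%g)%:M]scalemx1 scalerA.
move/(scale_unitmx_inj n0 (unitmx1 F n)) => ->; rewrite ffunE.
by rewrite mulfK // mulrC mulfVK // cocycle_neq0.
Qed.
End AbelianPairing.

(** * Products of two cyclic groups of the same order *)
Lemma prim_root_exists (F : numClosedFieldType) n :
  (0 < n)%N -> exists z : F, n.-primitive_root z.
Proof.
move=> n0; pose p : {poly F} := 'X^n - 1.
have [r Dp] := closed_field_poly_normal p.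
rewrite (monicP _) ?monicXnsubC // scale1r in Dp.
have rn1: all n.-unity_root r by apply/allP=> z; rewrite -root_prod_XsubC -Dp.
have sz_r: (n < (size r).+1)%N.
  by rewrite -(size_prod_XsubC r id) -Dp size_XnsubC.
have [|z] := hasP (has_prim_root n0 rn1 _ sz_r); last by exists z.
rewrite -separable_prod_XsubC -Dp separable_Xn_sub_1 //.
by rewrite pnatr_eq0 -lt0n.
Qed.

Section Rank2.
Variables (F : numClosedFieldType) (gT : finGroupType) (m : nat) (x y : gT).
Hypothesis defG : (<[x]> \x <[y]>)%g = [set: gT].
Hypotheses (ox : #[x]%g = m) (oy : #[y]%g = m).
Implicit Type f : cocycle F gT.

Lemma rank2_gt0 : (0 < m)%N. Proof. by rewrite -ox order_gt0. Qed.

Lemma rank2_coord g : exists ij : nat * nat, g = (x ^+ ij.1 * y ^+ ij.2)%g.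
Proof.
have [_ [_ [/cycleP[i ->] /cycleP[j ->] -> _]]] := mem_dprod defG (in_setT g).
by exists (i, j).
Qed.

Lemma rank2_abelian (g h : gT) : (g * h = h * g)%g.
Proof.
have [_ _ cxy _] := dprodP defG; have {}cxy : commute x y.
  by apply/esym/(centsP cxy); rewrite cycle_id.
have [[i j] ->] := rank2_coord g; have [[k l] ->] := rank2_coord h => /=.
have cc a b : commute (x ^+ a)%g (y ^+ b)%g by apply/commuteX2.
rewrite -mulgA [(y ^+ j * _)%g]mulgA -(cc k j) -mulgA -expgD addnC expgD.
rewrite [RHS]mulgA -[((x ^+ k * y ^+ l) * x ^+ i)%g]mulgA -(cc i l).
by rewrite !mulgA -!expgD addnC.
Qed.

Lemma rank2_coord_inj i j k l :
  (x ^+ i * y ^+ j = x ^+ k * y ^+ l)%g -> i = k %[mod m] /\ j = l %[mod m].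
Proof.
have [u [v [_ _ _ uniq]]] := mem_dprod defG (in_setT (x ^+ k * y ^+ l)%g).
move=> e; have [] := uniq (x ^+ i)%g (y ^+ j)%g; rewrite ?mem_cycle //.
have [] := uniq (x ^+ k)%g (y ^+ l)%g; rewrite ?mem_cycle //.
move=> <- <- /eqP + /eqP; rewrite !eq_expg_mod_order ox oy.
by move=> /eqP-> /eqP->.
Qed.

Lemma rank2_card : #|gT| = (m * m)%N.
Proof. by rewrite -cardsT -(dprod_card defG) -{1}ox -oy. Qed.

(** If the value w at (x, y) had order m' < m, then x^m' would be orthogonal to
the whole group; so p(x^m') would be scalar, whereas its trace is 0. *)
Lemma rank2_pairing_prim f :
  is_matrix_alg (twisted_alg f) -> m.-primitive_root (comm_pairing f x y).
Proof.
case/is_matrix_algP=> n [p [fp nn tr0]]; have n0 := square_card_gt0 nn.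
have sp : spanning p.
  by apply/spanning_indep => //; apply: (proj_rep_trace_indep fp).
set w := comm_pairing f x y.
have w1 : w ^+ m = 1.
  by rewrite -(comm_pairingXl rank2_abelian) -ox expg_order comm_pairing1l.
have [m' w_prim m'm] := prim_order_exists rank2_gt0 w1.
suff /eqP x1 : (x ^+ m' == 1)%g.
  suff -> : m = m' by [].
  by apply/eqP; rewrite eqn_dvd m'm andbT -ox order_dvdn x1.
apply: contraT => /tr0 trx.
have /is_scalar_mxP[c cE] : is_scalar_mx (p (x ^+ m')%g).
  apply: (spanning_scalar_commutant sp) => g.
  rewrite (comm_pairing_rep rank2_abelian fp).
  have [[k l] ->] /= := rank2_coord g.
  have := comm_pairing_gen rank2_abelian f x y m' 0 k l.
  rewrite expg0 mulg1 mul0n expr0 divr1 exprM.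
  rewrite (prim_expr_order w_prim) expr1n => ->.
  by rewrite scale1r.
move: trx; rewrite cE mxtrace_scalar => /eqP; rewrite mulrn_eq0 eqn0Ngt n0 /=.
have := unitmx_neq0 n0 (proj_rep_unit fp (x ^+ m')%g); rewrite cE.
by move=> + /eqP c0; rewrite c0 -scalemx1 scale0r eqxx.
Qed.

(** Take the bicharacter z^(be g * al h), where (al, be) are the coordinates and
z is a primitive m-th root of 1. In a spanning representation of degree n, the
matrices of y and x commute up to the factor z; determinants give z^n = 1, so
m <= n, while n^2 <= |G| = m^2. *)
Lemma rank2_nondegenerate : exists f, is_matrix_alg (twisted_alg f).
Proof.
have [z z_prim] := prim_root_exists F rank2_gt0.
have [c cE] := choice rank2_coord.
pose al g := (c g).1; pose be g := (c g).2.
have cM g h : al (g * h)%g = al g + al h %[mod m] /\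
              be (g * h)%g = be g + be h %[mod m].
  apply: rank2_coord_inj; rewrite -cE !expgD {1}[g]cE {1}[h]cE.
  rewrite -!mulgA; congr (_ * _)%g.
  by rewrite !mulgA [(y ^+ _ * x ^+ _)%g]rank2_abelian.
have cP : is_cocycle [ffun gh => z ^+ (be gh.1 * al gh.2)].
  apply/andP; split.
    apply/forallP=> g; apply/forallP=> h; rewrite ffunE expf_neq0 //.
    by rewrite (prim_root_eq0 z_prim) -lt0n rank2_gt0.
  apply/forallP=> g; apply/forallP=> h; apply/forallP=> k; rewrite !ffunE /=.
  rewrite -!exprD (eq_prim_root_expr z_prim).
  rewrite -modnDmr -modnMml (cM g h).2 modnMml modnDmr.
  rewrite eq_sym -modnDmr -modnMmr (cM h k).1 modnMmr modnDmr.
  by apply/eqP; congr (_ %% _)%N; ring.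
pose f := Cocycle cP; exists f.
have [al_x be_x] : al x = 1 %[mod m] /\ be x = 0 %[mod m].
  by apply: rank2_coord_inj; rewrite -cE expg1 expg0 mulg1.
have [al_y be_y] : al y = 0 %[mod m] /\ be y = 1 %[mod m].
  by apply: rank2_coord_inj; rewrite -cE expg1 expg0 mul1g.
have fyx : comm_pairing f y x = z.
  have z1 i j k l : i = k %[mod m] -> j = l %[mod m] ->
      z ^+ (i * j) = z ^+ (k * l).
    move=> ik jl; apply/eqP; rewrite (eq_prim_root_expr z_prim).
    by rewrite -modnMm ik jl modnMm.
  rewrite /comm_pairing !ffunE /= (z1 _ _ _ _ be_y al_x).
  by rewrite (z1 _ _ _ _ be_x al_y) divr1.
have [n [p [n0 fp sp]]] := exists_spanning f.
have n_le : (n <= m)%N.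
  by rewrite -leq_sqr -!mulnn -rank2_card (spanning_le sp).
have m_n : (m %| n)%N.
  rewrite (prim_order_dvd z_prim); apply/eqP.
  have /(congr1 determinant) := comm_pairing_rep rank2_abelian fp y x.
  rewrite fyx detZ !det_mulmx [\det (p x) * _]mulrC => e.
  have d0 : \det (p y) * \det (p x) != 0.
    by rewrite -unitfE -det_mulmx -unitmxE unitmx_mul !(proj_rep_unit fp).
  by apply: (mulIf d0); rewrite mul1r.
have nm : n = m by apply/eqP; rewrite eqn_leq n_le dvdn_leq.
by apply: (spanning_is_matrix_alg fp) sp; rewrite nm rank2_card.
Qed.

(** The pairing at the images of x and y is its value w at (x, y) raised to the
power det A, and w has order m. *)
Lemma SL2_pairing f (phi : {perm gT}) :
  is_matrix_alg (twisted_alg f) -> phi \in Aut [set: gT] ->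
  (phi \in SL2 m x y) = (comm_pairing f (phi x) (phi y) == comm_pairing f x y).
Proof.
move=> /rank2_pairing_prim w_prim phiA; rewrite inE phiA /=.
have w0 := comm_pairing_neq0 f x y.
have detP (A : 'M['I_m]_2) :
    (\det (map_mx (fun i : 'I_m => (i : nat)%:Z) A) == 1 %[mod m])%Z =
    (comm_pairing f (x ^+ A ord0 ord0 * y ^+ A ord0 ord_max)%g
       (x ^+ A ord_max ord0 * y ^+ A ord_max ord_max)%g == comm_pairing f x y).
  rewrite (comm_pairing_gen rank2_abelian).
  rewrite (can2_eq (mulfVK (expf_neq0 _ w0)) (mulfK (expf_neq0 _ w0))) -exprS.
  rewrite (eq_prim_root_expr w_prim) (expand_det_row _ ord0).
  rewrite !big_ord_recl big_ord0 /cofactor !det_mx11 !mxE /=.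
  have -> : lift ord0 ord0 = ord_max :> 'I_2 by apply/val_inj.
  have -> : lift ord_max 0 = ord0 :> 'I_2 by apply/val_inj.
  rewrite -(eqz_modDr (A ord0 ord_max * A ord_max ord0)%N%:Z) -intS.
  have -> : forall a b c d : nat, a%:Z * ((-1) ^+ (0 + 0) * d%:Z) +
     (b%:Z * ((-1) ^+ (0 + bump 0 0) * c%:Z) + 0) + (b * c)%N%:Z = (a * d)%N%:Z.
    move=> a b c d; rewrite !PoszM expr0 expr1; ring.
  by rewrite !modz_nat eqz_nat.
apply/existsP/eqP=> [[A /and3P[/eqP-> /eqP->]]|e].
  by rewrite detP => /eqP.
have m0 := rank2_gt0.
have xE k : (x ^+ (Ordinal (ltn_pmod k m0)) = x ^+ k)%g.
  by apply/eqP; rewrite eq_expg_mod_order ox modn_mod.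
have yE k : (y ^+ (Ordinal (ltn_pmod k m0)) = y ^+ k)%g.
  by apply/eqP; rewrite eq_expg_mod_order oy modn_mod.
have [[a b] phix] := rank2_coord (phi x).
have [[c d] phiy] := rank2_coord (phi y).
pose A : 'M_2 := \matrix_(i < 2, j < 2)
  Ordinal (ltn_pmod (if i == ord0 then if j == ord0 then a else b
                     else if j == ord0 then c else d) m0).
by exists A; rewrite detP !mxE /= !xE !yE -phix -phiy e !eqxx.
Qed.
End Rank2.

Section Rank2Symplectic.
Variables (F : numClosedFieldType) (N K : finGroupType) (m : nat) (x y : N).
Variable eta : groupAction [set: K] [set: N].
Hypothesis defN : (<[x]> \x <[y]>)%g = [set: N].
Hypotheses (ox : #[x]%g = m) (oy : #[y]%g = m).

Lemma rank2_symplectic :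
  symplectic F eta <-> (actperm eta @* [set: K] \subset SL2 m x y)%g.
Proof.
have abelN := rank2_abelian defN.
have phiA k : actperm eta k \in Aut [set: N] by apply: actperm_Aut; rewrite inE.
have phiP (f : cocycle F N) k : is_matrix_alg (twisted_alg f) ->
    (actperm eta k \in SL2 m x y) =
    (comm_pairing (act_cocycle eta k f) x y == comm_pairing f x y).
  move=> fM; rewrite (SL2_pairing defN ox oy fM (phiA k)) !actpermE.
  by rewrite /comm_pairing !pullbackE.
split=> [/symplecticP[f fM fK] | /subsetP etaSL].
  apply/subsetP=> _ /morphimP[k _ _ ->]; rewrite (phiP f) //.
  have /(cohomologous_comm_pairing abelN) fkE := fK k.
  by rewrite -fkE.
have [f fM] := rank2_nondegenerate F defN ox oy.
apply/symplecticP; exists f => // k; apply/(cohomologous_comm_pairing abelN).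
have /etaSL : actperm eta k \in (actperm eta @* [set: K])%g.
  by apply: mem_morphim; rewrite inE.
rewrite (phiP f) // => /eqP fk g h.
have [[i j] ->] := rank2_coord defN g; have [[k' l] ->] := rank2_coord defN h.
by rewrite !comm_pairing_gen // fk.
Qed.

Lemma rank2_central_type : central_type F N.
Proof.
have [f fM] := rank2_nondegenerate F defN ox oy.
by exists (coh_class f); apply/nondegenerateE.
Qed.
End Rank2Symplectic.

Local Open Scope group_scope.

Theorem theorem3p17 (R : realType) (N K : finGroupType)
    (eta : groupAction [set: K] [set: N]) (coNK : coprime #|N| #|K|) :
  (central_type R[i] (sdprod_by eta) <->
     [/\ central_type R[i] N, central_type R[i] K & symplectic R[i] eta]) /\
  (forall (m : nat) (x y : N),
     <[x]> \x <[y]> = [set: N] -> #[x] = m -> #[y] = m ->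
     (central_type R[i] (sdprod_by eta) <->
        central_type R[i] K /\ actperm eta @* [set: K] \subset SL2 m x y)).
Proof.
have sdP : central_type R[i] (sdprod_by eta) <->
    [/\ central_type R[i] N, central_type R[i] K & symplectic R[i] eta].
  split; first exact: central_type_sdprod_factors.
  by case=> _; apply: sdprod_central_type.
split=> // m x y defN ox oy.
rewrite sdP -(rank2_symplectic R[i] eta defN ox oy).
split=> [[_ KC etaS]|[KC etaS]] //; split=> //.
exact: rank2_central_type defN ox oy.
Qed.
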